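(* Let $q$ be a prime power and let $n,m,h$ be positive integers with $m\geq 3$ and $2\leq h\leq n-2$. Let $\mathbf{A}=(\alpha_1,\dots,\alpha_m)\in(\mathbb{F}_{q^n}^* )^m$ be such that $K_{\mathbf{A}}:=\alpha_1^{q^{m-1}}\alpha_2\alpha_3^{q}\cdots\alpha_m^{q^{m-2}}$ is not a $(1+q+\cdots+q^{m-1})$-th power in $\mathbb{F}_{q^n}$. Then the $\mathbb{F}_q$-subspace $$V_{\mathbf{A},h}:=\{(\underline{x},\underline{x}^q,\dots,\underline{x}^{q^{h-1}},f_1(\underline{x}),\dots,f_m(\underline{x})):\underline{x}\in\mathbb{F}_{q^n}^m\}\subseteq\mathbb{F}_{q^n}^{m(h+1)},$$ where $f_i(\underline{x})=x_i^{q^h}+\alpha_{i+1}x_{i+1}^{q^{h+1}}$ for $i=1,\dots,m-1$ and $f_m(\underline{x})=x_m^{q^h}+\alpha_1x_1^{q^{h+1}}$, is $\big(m(h+1)-(h+1),\ mn-(2n-2h-2)\big)$-evasive.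
   Context: For $\underline{x}=(x_1,\dots,x_m)$, $\underline{x}^{q^j}=(x_1^{q^j},\dots,x_m^{q^j})$. Let $a<k$ and $a\leq r$ be positive integers. An $\mathbb{F}_q$-subspace $U\subseteq\mathbb{F}_{q^n}^k$ is $(a,r)$-evasive if for every $a$-dimensional $\mathbb{F}_{q^n}$-subspace $H\subseteq\mathbb{F}_{q^n}^k$ one has $\dim_{\mathbb{F}_q}(U\cap H)\leq r$. *)

(* Defs.v *)
From HB Require Import structures.
From mathcomp Require Import all_boot all_order all_algebra all_field.

Set Implicit Arguments.
Unset Strict Implicit.
Unset Printing Implicit Defensive.

Import GRing.Theory.

Local Open Scope ring_scope.

(* Throughout, F is the field with q := #|F| elements and L an extension of F;
   L is the field with q ^ n elements when \dim {:L} = n.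
   The carrier of L^k is {ffun 'I_k -> L}; as an F-space it is
   {ffun 'I_k -> L}, and as an L-space it is {ffun 'I_k -> L^o}. *)

(* An L-subspace H of L^k regarded as an F-subspace.  It is obtained as the
   range of the projection onto H; its elements are exactly those of H,
   see mem_restrict_scalars. *)
Definition restrict_scalars (F : fieldType) (L : fieldExtType F) (k : nat)
    (H : {vspace {ffun 'I_k -> L^o}}) : {vspace {ffun 'I_k -> L}} :=
  limg (linfun (projv H : {ffun 'I_k -> L} -> {ffun 'I_k -> L})).

Lemma mem_restrict_scalars (F : fieldType) (L : fieldExtType F) (k : nat)
    (H : {vspace {ffun 'I_k -> L^o}}) (v : {ffun 'I_k -> L}) :
  (v \in restrict_scalars H) = ((v : {ffun 'I_k -> L^o}) \in H).
Proof.
pose p : {ffun 'I_k -> L} -> {ffun 'I_k -> L} := projv H.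
have p_lin : linear p.
  move=> c u w.
  have -> : c *: u + w =
      (c%:A : L) *: (u : {ffun 'I_k -> L^o}) + (w : {ffun 'I_k -> L^o}).
    by apply/ffunP=> i; rewrite !ffunE /GRing.scale /= mulr_algl.
  rewrite /p linearP; apply/ffunP=> i.
  by rewrite !ffunE /GRing.scale /= mulr_algl.
pose pL := GRing.isLinear.Build _ _ _ _ p p_lin.
pose p' : {linear {ffun 'I_k -> L} -> {ffun 'I_k -> L}} :=
  HB.pack p pL.
have pE u : linfun p u = p u by apply: (lfunE p').
apply/memv_imgP/idP => [[u _ ->] | Hv].
  by rewrite pE; apply: memv_proj.
by exists v; rewrite ?memvf // pE /p projv_id.
Qed.

(* The constraints on the parameters a and r are part of the definition. *)
Definition evasive (F : fieldType) (L : fieldExtType F) (k a r : nat)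
    (U : {vspace {ffun 'I_k -> L}}) : Prop :=
  [/\ (0 < a)%N, (a < k)%N, (a <= r)%N &
      forall H : {vspace {ffun 'I_k -> L^o}},
        \dim H = a -> (\dim (U :&: restrict_scalars H)%VS <= r)%N].

Section EvasiveFamily.

Variables (F : finFieldType) (L : fieldExtType F) (m : nat).
Variable alpha : 'I_m -> L.

(* ordS is the cyclic successor on 'I_m.  With 0-based indices, the factor of
   rank j < m - 1 is alpha_(j+1) ^ (q ^ j), and the last one is
   alpha_0 ^ (q ^ (m-1)). *)
Definition K_A : L := \prod_(j < m) alpha (ordS j) ^+ (#|F| ^ j).

(* f_i(x) = x_i ^ (q ^ h) + alpha_(i+1) x_(i+1) ^ (q ^ (h+1)), with cyclic
   indices. *)
Definition f_A (h : nat) (i : 'I_m) (x : {ffun 'I_m -> L}) : L :=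
  x i ^+ (#|F| ^ h) + alpha (ordS i) * x (ordS i) ^+ (#|F| ^ h.+1).

(* The vector (x, x^q, ..., x^(q^(h-1)), f_1(x), ..., f_m(x)): the rows of an
   (h+1) x m matrix, concatenated by mxvec. *)
Definition V_vec (h : nat) (x : {ffun 'I_m -> L}) : {ffun 'I_(h.+1 * m) -> L} :=
  [ffun k => mxvec (\matrix_(j < h.+1, i < m)
    if (j < h)%N then x i ^+ (#|F| ^ j) else f_A h i x) 0 k].

Definition V_A (h : nat) : {vspace {ffun 'I_(h.+1 * m) -> L}} :=
  limg (linfun (V_vec h)).

Lemma expF_linear (j : nat) (c : F) (x y : L) :
  (c *: x + y) ^+ (#|F| ^ j) = c *: x ^+ (#|F| ^ j) + y ^+ (#|F| ^ j).
Proof.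
elim: j => [|j IH]; first by rewrite expn0 !expr1.
rewrite expnSr !exprM {}IH.
have [p p_pr pF] := finPcharP F.
have pL : p \in [pchar L] by rewrite pchar_lalg.
rewrite exprDn_pchar; last first.
  by rewrite (eq_pnat _ (pcharf_eq pL)) (card_primeChar pF) pnatX pnat_id.
by rewrite exprZn expf_card.
Qed.

Lemma V_vec_linear (h : nat) : linear (V_vec h).
Proof.
move=> c x y; apply/ffunP=> k; rewrite !ffunE.
case/mxvec_indexP: k => j i; rewrite !mxvecE !mxE.
case: ifP => _; rewrite ?ffunE ?expF_linear //.
rewrite /f_A !ffunE !expF_linear mulrDr scalerDr -scalerAr.
by rewrite addrACA.
Qed.

HB.instance Definition _ (h : nat) :=
  GRing.isLinear.Build F {ffun 'I_m -> L} {ffun 'I_(h.+1 * m) -> L} _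
    (V_vec h) (V_vec_linear h).

Lemma mem_V_A (h : nat) (v : {ffun 'I_(h.+1 * m) -> L}) :
  reflect (exists x, v = V_vec h x) (v \in V_A h).
Proof.
apply: (iffP memv_imgP) => [[x _ ->] | [x ->]]; exists x; rewrite ?memvf //.
  by rewrite lfunE.
by rewrite lfunE.
Qed.

End EvasiveFamily.

(* Main.v *)
(** Let W be the F-space of the x with V_vec x in H, and let A be the L-space of
    all q-polynomials in x_1, ..., x_m of q-degree less than n that vanish on W;
    then dim_L A <= mn - dim_F W, so it suffices to show dim_L A >= 2(n - h - 1).
    Since A is stable under g |-> g^q, the leading coefficient vectors in q-degree
    d span a space whose dimension lambda_d is nondecreasing in d, and dim_L A is
    the sum of the lambda_d over d < n.  If lambda_(h+1) >= 2 we are done.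
    Otherwise lambda_d <= 1 for all d <= h+1.  The linear forms vanishing on H
    give an (h+1)-dimensional subspace D of A whose elements have q-degree at most
    h+1, and never exactly h, because in D the coefficient vector of degree h+1
    vanishes only with that of degree h.  Counting dimensions, D contains a
    nonzero constant vector v and some f of degree exactly h+1.  As the leading
    spaces of A in degrees h and h+1 are the lines through the Frobenius twists
    of v, both top coefficient vectors of f are multiples of these twists.  With
    u = v^(q^h) this reads t u_(i+1)^q = s alpha_(i+1) u_i, and going once around
    the cycle makes K_A a (1 + q + ... + q^(m-1))-th power. *)

Require Import Defs.
From HB Require Import structures.
From mathcomp Require Import all_boot all_order all_algebra all_field.
From mathcomp Require Import zify ring.

Set Implicit Arguments.
Unset Strict Implicit.
Unset Printing Implicit Defensive.

Import GRing.Theory.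
Local Open Scope ring_scope.

(** * Dimension under semilinear maps *)

Lemma leq_dim_map_mx (K : fieldType) (s : {rmorphism K -> K}) (m : nat)
    (U V : {vspace 'rV[K]_m}) :
  (forall u, u \in U -> map_mx s u \in V) -> (\dim U <= \dim V)%N.
Proof.
move=> sUV; pose B := \matrix_(i < \dim U) (vbasis U)`_i.
have B_free : row_free B.
  apply: inj_row_free => u; rewrite mulmx_sum_row => uB0.
  apply/rowP=> i; rewrite mxE.
  apply: (freeP (basis_free (vbasisP U)) (u 0)).
  by rewrite -[RHS]uB0; apply: eq_bigr => j _; rewrite rowK.
pose X := [tuple row i (map_mx s B) | i < \dim U].
have X_free : free X.
  apply/freeP=> k kX0 i.
  (* [map_mx s] is only semilinear, but a field morphism preserves the rank of [B], so the images of
     a basis stay independent. *)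
  have /row_freeP[C BC] : row_free (map_mx s B) by rewrite row_free_map.
  have: (\row_j k j) *m map_mx s B = 0.
    rewrite mulmx_sum_row -[RHS]kX0; apply: eq_bigr => j _.
    by rewrite mxE -tnth_nth tnth_mktuple.
  move/(congr1 (mulmx^~ C)); rewrite -mulmxA BC mulmx1 mul0mx.
  by move/rowP/(_ i); rewrite !mxE.
have <- : \dim <<X>> = \dim U by rewrite (eqP X_free) size_tuple.
apply: dimvS; apply/span_subvP=> _ /tnthP[i ->].
rewrite tnth_mktuple -map_row rowK; apply: sUV.
by apply: vbasis_mem; rewrite mem_nth ?size_tuple.
Qed.

Lemma dim1_collinear (K : fieldType) (vT : vectType K) (U : {vspace vT})
    (u v : vT) :
  (\dim U <= 1)%N -> u \in U -> v \in U -> v != 0 -> exists c, u = c *: v.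
Proof.
move=> dimU uU vU v0; apply/vlineP.
suff -> : <[v]>%VS = U by [].
by apply/eqP; rewrite eqEdim -memvE vU dim_vline v0.
Qed.

(** * Filtration by degree and leading coefficients *)

Section LeadingRows.

Variables (K : fieldType) (s : {rmorphism K -> K}) (N m : nat).
Implicit Types (A : {vspace 'M[K]_(N.+1, m)}) (M : 'M[K]_(N.+1, m)).

(* Row i of M is the coefficient vector in degree i of a polynomial with vector
   coefficients. *)
Definition rows_from (d : nat) M : 'M[K]_(N.+1, m) :=
  \matrix_(i, j) if (d <= i)%N then M i j else 0.

Lemma rows_from_linear d : linear (rows_from d).
Proof.
move=> c M M'; apply/matrixP=> i j; rewrite !mxE.
by case: ifP; rewrite ?mulr0 ?addr0.
Qed.

HB.instance Definition _ d :=
  GRing.isLinear.Build _ _ _ _ (rows_from d) (rows_from_linear d).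

Definition deg_lt A (d : nat) := (A :&: lker (linfun (rows_from d)))%VS.

Lemma mem_deg_lt A d M :
  reflect (M \in A /\ forall (i : 'I_N.+1) j, (d <= i)%N -> M i j = 0)
          (M \in deg_lt A d).
Proof.
rewrite memv_cap memv_ker lfunE /=.
apply: (iffP andP) => -[MA M0]; split=> //.
  by move=> i j di; move/eqP/matrixP/(_ i j): M0; rewrite !mxE di.
by apply/eqP/matrixP=> i j; rewrite !mxE; case: ifP => // /M0.
Qed.

(** For [d > N], [inord d] defaults to row 0, so the dimension counts require [d <= N]. *)
Definition lead A (d : nat) : {vspace 'rV[K]_m} :=
  (linfun (row (inord d)) @: deg_lt A d.+1)%VS.

Lemma mem_lead A d u :
  reflect (exists2 M, M \in deg_lt A d.+1 & u = row (inord d) M)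
          (u \in lead A d).
Proof.
by apply: (iffP memv_imgP) => -[M MA ->]; exists M; rewrite ?lfunE.
Qed.

(** Rank-nullity for the map extracting row [d]. *)
Lemma dim_deg_ltS A d :
  (d <= N)%N -> \dim (deg_lt A d.+1) = (\dim (deg_lt A d) + \dim (lead A d))%N.
Proof.
move=> dN; rewrite -(limg_ker_dim (linfun (row (inord d))) (deg_lt A d.+1)).
congr (\dim _ + _)%N; apply/vspaceP=> M.
rewrite memv_cap memv_ker lfunE /=; apply/andP/mem_deg_lt.
  case=> /mem_deg_lt[MA M0] /eqP/rowP Md; split=> // i j.
  rewrite leq_eqVlt => /predU1P[di|]; last exact: M0.
  by have := Md j; rewrite !mxE di inord_val.
case=> MA M0; split.
  by apply/mem_deg_lt; split=> // i j /ltnW; apply: M0.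
by apply/eqP/rowP=> j; rewrite !mxE M0 // inordK.
Qed.

Lemma dim_deg_lt A d :
  (d <= N.+1)%N -> \dim (deg_lt A d) = (\sum_(i < d) \dim (lead A i))%N.
Proof.
elim: d => [_|d IHd dN].
  rewrite big_ord0; apply/eqP; rewrite dimv_eq0 -subv0; apply/subvP=> M.
  case/mem_deg_lt=> _ M0; rewrite memv0; apply/eqP/matrixP=> i j.
  by rewrite M0 ?mxE.
by rewrite dim_deg_ltS // big_ord_recr /= IHd // ltnW.
Qed.

Lemma deg_lt_full A d :
  (forall M (i : 'I_N.+1) j, M \in A -> (d <= i)%N -> M i j = 0) ->
  deg_lt A d = A.
Proof.
move=> A0; apply/vspaceP=> M; apply/mem_deg_lt/idP => [[]//|MA].
by split=> // i j; apply: A0.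
Qed.

Lemma dim_sum_lead A : \dim A = (\sum_(i < N.+1) \dim (lead A i))%N.
Proof.
rewrite -dim_deg_lt // deg_lt_full // => M i j _.
by rewrite leqNgt ltn_ord.
Qed.

Lemma lead_sub A B d : (A <= B)%VS -> (lead A d <= lead B d)%VS.
Proof. by move=> AB; apply: limgS; apply: capvS. Qed.

(* [ord_pred] wraps around, which matches x ^ (q ^ n) = x in [q_eval_shift]. *)
Definition shift M : 'M[K]_(N.+1, m) := \matrix_(i, j) s (M (ord_pred i) j).

(** The shift carries row [d] to row [d.+1], twisted by [s]; [d < N] keeps it from wrapping around
    to row 0. *)
Lemma lead_shift A d u :
  (forall M, M \in A -> shift M \in A) -> (d < N)%N ->
  u \in lead A d -> map_mx s u \in lead A d.+1.
Proof.
move=> shA dN /mem_lead[M /mem_deg_lt[MA M0] ->].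
have predE (i : 'I_N.+1) : (0 < i)%N -> ord_pred i = i.-1 :> nat.
  case: i => -[//|i] /= iN _.
  by rewrite modnDr modn_small // ltnW.
apply/mem_lead; exists (shift M).
  apply/mem_deg_lt; split=> [|i j di]; first exact: shA.
  by rewrite mxE M0 ?rmorph0 // predE; lia.
apply/rowP=> j; rewrite !mxE; congr (s (M _ _)); apply: ord_inj.
by rewrite predE !inordK //; lia.
Qed.

Lemma leq_dim_lead A d d' :
  (forall M, M \in A -> shift M \in A) -> (d <= d')%N -> (d' <= N)%N ->
  (\dim (lead A d) <= \dim (lead A d'))%N.
Proof.
move=> shA; elim: d' => [|d' IHd]; first by rewrite leqn0 => /eqP->.
rewrite leq_eqVlt => /predU1P[->//|dd'] d'N.
apply: leq_trans (IHd dd' (ltnW d'N)) _.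
by apply: (@leq_dim_map_mx _ s) => u; apply: lead_shift.
Qed.

End LeadingRows.

(** * q-polynomials as coefficient matrices, and those vanishing on a subspace *)

Section QPolynomials.

Variables (F : finFieldType) (L : fieldExtType F).
Local Notation q := #|F|.

Definition frob (x : L) : L := x ^+ q.

Lemma frob_zmod : zmod_morphism frob.
Proof.
move=> x y; rewrite /frob -[q]expn1 addrC -[- y]scaleN1r expF_linear.
by rewrite scaleN1r addrC.
Qed.

Lemma frob_monoid : monoid_morphism frob.
Proof. by split=> [|x y]; rewrite /frob ?expr1n ?exprMn. Qed.

HB.instance Definition _ := GRing.isZmodMorphism.Build L L frob frob_zmod.
HB.instance Definition _ := GRing.isMonoidMorphism.Build L L frob frob_monoid.

Lemma expf_card_dim (x : L) : x ^+ (q ^ \dim {:L}) = x.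
Proof.
have <- : #|finvect_type L| = (q ^ \dim {:L})%N.
  by rewrite -(card_vspacef (Vector.class (finvect_type L))) card_vspace.
exact: (@expf_card (finvect_type L) x).
Qed.

Variables (N m : nat).
Hypothesis dimL : \dim {:L} = N.+1.

Definition q_eval (M : 'M[L]_(N.+1, m)) (x : {ffun 'I_m -> L}) : L :=
  \sum_i \sum_j M i j * x j ^+ (q ^ i).

Lemma q_eval_linear M : linear (q_eval M).
Proof.
move=> c x y; rewrite /q_eval scaler_sumr -big_split; apply: eq_bigr => i _.
rewrite scaler_sumr -big_split; apply: eq_bigr => j _.
by rewrite !ffunE expF_linear mulrDr scalerAr.
Qed.

HB.instance Definition _ M :=
  GRing.isLinear.Build F {ffun 'I_m -> L} L _ (q_eval M) (q_eval_linear M).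

Definition q_evals p (X : p.-tuple {ffun 'I_m -> L}) (M : 'M[L]_(N.+1, m)) :
  'rV[L]_p := \row_k q_eval M X`_k.

Lemma q_evals_linear p X : linear (@q_evals p X).
Proof.
move=> c M M'; apply/rowP=> k; rewrite !mxE /q_eval mulr_sumr -big_split.
apply: eq_bigr => i _; rewrite mulr_sumr -big_split; apply: eq_bigr => j _.
by rewrite !mxE mulrDl mulrA.
Qed.

HB.instance Definition _ p X :=
  GRing.isLinear.Build L 'M[L]_(N.+1, m) 'rV[L]_p _ (@q_evals p X)
    (@q_evals_linear p X).

(** On each coordinate axis [M] gives a univariate polynomial of degree below [q ^ N.+1], the size
    of [L], with every point of [L] as a root. *)
Lemma q_eval_inj M : (forall x, q_eval M x = 0) -> M = 0.
Proof.
move=> M0; apply/matrixP=> i0 j; rewrite mxE.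
have q_gt1 : (1 < q)%N by apply: finRing_gt1.
pose p : {poly L} := \sum_(i < N.+1) M i j *: 'X^(q ^ i).
have p_coef : p`_(q ^ i0) = M i0 j.
  rewrite coef_sum (bigD1 i0) //= coefZ coefXn eqxx mulr1 big1 ?addr0 // => i ii0.
  by rewrite coefZ coefXn eqn_exp2l // eq_sym val_eqE (negPf ii0) mulr0.
suff p0 : p = 0 by rewrite -p_coef p0 coef0.
apply/eqP; apply: contraTT isT => p_neq0.
have roots_p : all (root p) (enum (finvect_type L)).
  apply/allP=> y _; apply/rootP; rewrite horner_sum.
  rewrite -[RHS](M0 [ffun k => if k == j then y else 0]).
  apply: eq_bigr => i _; rewrite !hornerE (bigD1 j) //= ffunE eqxx.
  rewrite big1 ?addr0 // => k kj.
  by rewrite ffunE (negPf kj) expr0n gtn_eqF ?mulr0 // expn_gt0 ltnW.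
suff: (size p <= size (enum (finvect_type L)))%N.
  by rewrite leqNgt (max_poly_roots p_neq0 roots_p (enum_uniq (finvect_type L))).
rewrite -cardE -(card_vspacef (Vector.class (finvect_type L))) card_vspace.
rewrite [\dim _]dimL.
apply: leq_trans (size_sum _ _ _) _; apply/bigmax_leqP=> i _.
apply: leq_trans (size_scale_leq _ _) _.
by rewrite size_polyXn ltn_exp2l.
Qed.

(** By F-linearity in [x], testing on an F-basis of [W] suffices; this makes the condition an
    L-linear kernel. *)
Definition q_ann (W : {vspace {ffun 'I_m -> L}}) : {vspace 'M[L]_(N.+1, m)} :=
  lker (linfun (q_evals (vbasis W))).

Lemma mem_q_ann (W : {vspace {ffun 'I_m -> L}}) M :
  reflect (forall x, x \in W -> q_eval M x = 0) (M \in q_ann W).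
Proof.
rewrite memv_ker lfunE /=; apply: (iffP eqP) => [/rowP M0 x xW|M0].
  rewrite (coord_vbasis xW) linear_sum big1 // => k _.
  by rewrite linearZ /=; have := M0 k; rewrite !mxE => ->; rewrite scaler0.
apply/rowP=> k; rewrite !mxE M0 //.
by apply: vbasis_mem; rewrite mem_nth ?size_tuple.
Qed.

(** Evaluation on a basis of a complement of [W] is injective on [q_ann W]: vanishing on both
    summands means vanishing everywhere. *)
Lemma dim_q_ann W : (\dim (q_ann W) + \dim W <= m * N.+1)%N.
Proof.
have <- : \dim {: {ffun 'I_m -> L}} = (m * N.+1)%N.
  by rewrite dimvf -dimL dimvf -[in RHS](card_ord m).
have -> : \dim {: {ffun 'I_m -> L}} = (\dim (W^C)%VS + \dim W)%N.
  by rewrite dimv_compl subnK // dimvS ?subvf.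
rewrite leq_add2r -(limg_dim_eq (f := linfun (q_evals (vbasis (W^C)%VS)))).
  by apply: leq_trans (dimvS (subvf _)) _; rewrite dimvf dim_matrix mul1r.
apply/eqP; rewrite -subv0; apply/subvP=> M.
rewrite memv_cap => /andP[/mem_q_ann MW]; rewrite -/(q_ann _) => /mem_q_ann MWC.
rewrite memv0; apply/eqP/q_eval_inj => x.
have : x \in (W + W^C)%VS by rewrite addv_complf memvf.
by case/memv_addP=> w wW [w' wW' ->]; rewrite linearD /= MW ?MWC ?addr0.
Qed.

Lemma q_eval_shift M x : q_eval (shift frob M) x = frob (q_eval M x).
Proof.
rewrite /q_eval rmorph_sum (reindex_inj (@ordS_inj _)); apply: eq_bigr => i _.
rewrite rmorph_sum; apply: eq_bigr => j _; rewrite mxE ordSK rmorphM.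
congr (_ * _); rewrite /= /frob -exprM -expnSr.
have [iN|Ni] := ltnP i N; first by rewrite /= modn_small.
have iE : i = N :> nat by apply/eqP; rewrite eqn_leq Ni -ltnS ltn_ord.
by rewrite /= iE modnn -dimL expf_card_dim.
Qed.

Lemma shift_q_ann (W : {vspace {ffun 'I_m -> L}}) M :
  M \in q_ann W -> shift frob M \in q_ann W.
Proof.
move=> /mem_q_ann MW; apply/mem_q_ann=> x xW.
by rewrite q_eval_shift MW ?rmorph0.
Qed.

End QPolynomials.

(** * The recursion around the cycle *)

Lemma K_A_power (F : finFieldType) (L : fieldExtType F) (m : nat)
    (alpha u : 'I_m -> L) (s t : L) :
    (exists i, u i != 0) -> t != 0 ->
    (forall i, t * u (ordS i) ^+ #|F| = s * u i * alpha (ordS i)) ->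
  exists b : L, b ^+ (\sum_(j < m) #|F| ^ j)%N = K_A alpha.
Proof.
case: m alpha u => [|m] alpha u [i ui_neq0] t_neq0 u_rec; first by case: i ui_neq0.
set q := #|F| in u_rec *; have q_gt0 : (0 < q)%N by rewrite ltnW ?finRing_gt1.
pose c p : 'I_m.+1 := inord (p %% m.+1).
have cS p : c p.+1 = ordS (c p).
  apply: ord_inj; rewrite /= !inordK ?ltn_mod //.
  by rewrite -[(p %% _).+1]addn1 modnDml addn1.
have c_id (j : 'I_m.+1) : c j = j.
  by apply: ord_inj; rewrite inordK ?ltn_mod // modn_small.
have cm : c m.+1 = c 0 by rewrite /c modnn mod0n.
(* A zero would propagate around the whole cycle, so [u (c 0)] is nonzero. *)
have u_next p : u (c p) = 0 -> u (c p.+1) = 0.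
  move=> up0; have := u_rec (c p); rewrite up0 mulr0 mul0r -cS => /eqP.
  by rewrite mulf_eq0 (negPf t_neq0) expf_eq0 q_gt0 => /eqP.
have u0_neq0 : u (c 0) != 0.
  apply: contra ui_neq0 => /eqP u0; rewrite -(c_id i).
  by elim: (i : nat) => [|p /eqP/u_next ->]; rewrite ?u0.
have s_neq0 : s != 0.
  apply: contra u0_neq0 => /eqP s0; rewrite -cm.
  have := u_rec (c m); rewrite s0 !mul0r -cS => /eqP.
  by rewrite mulf_eq0 (negPf t_neq0) expf_eq0 q_gt0.
have telescope p :
    s ^+ (\sum_(j < p) q ^ j)%N * (\prod_(j < p) alpha (c j.+1) ^+ (q ^ j))
      * u (c 0)
    = t ^+ (\sum_(j < p) q ^ j)%N * u (c p) ^+ (q ^ p).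
  elim: p => [|p IHp]; first by rewrite !big_ord0 !expr0 expr1 !mul1r.
  rewrite !big_ord_recr /= !exprD.
  have /(congr1 (fun z => z ^+ (q ^ p))) := u_rec (c p).
  rewrite -cS !exprMn -exprM -expnS => up_rec.
  rewrite -[RHS]mulrA up_rec !mulrA [t ^+ _ * _ * _]mulrAC -IHp.
  by ring.
exists (t / s * u (c 0) ^+ q.-1).
have := telescope m.+1; rewrite cm.
have -> : \prod_(j < m.+1) alpha (c j.+1) ^+ (q ^ j) = K_A alpha.
  by apply: eq_bigr => j _; rewrite cS c_id.
set S := (\sum_(j < m.+1) q ^ j)%N => KE.
have qE : (q ^ m.+1 = (q.-1 * S).+1)%N.
  by rewrite -predn_exp prednK ?expn_gt0 ?q_gt0.
rewrite qE exprSr mulrA in KE; move/(mulIf u0_neq0): KE => KE.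
by rewrite exprMn exprMn -exprM exprVn mulrAC -KE mulrAC mulfV ?mul1r ?expf_neq0.
Qed.

(** * Frobenius twists of a linear form *)

Section HomogeneousRows.

Variables (F : finFieldType) (L : fieldExtType F) (N m : nat).
Local Notation q := #|F|.
Implicit Types (A : {vspace 'M[L]_(N.+1, m)}) (v : 'rV[L]_m).

(** For [d <= N], the coefficients of the linear form with vector [v] raised to the power
    [q ^ d]. *)
Definition monom_mx (d : nat) (v : 'rV[L]_m) : 'M[L]_(N.+1, m) :=
  \matrix_(i, j) if i == d :> nat then v 0 j ^+ (q ^ d) else 0.

Lemma monom_mx_shift A v d :
    (forall M, M \in A -> shift (@frob F L) M \in A) ->
  monom_mx 0 v \in A -> (d <= N)%N -> monom_mx d v \in A.
Proof.
move=> shA v0A; elim: d => // d IHd dN.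
have -> : monom_mx d.+1 v = shift (@frob F L) (monom_mx d v).
  apply/matrixP=> i j; rewrite !mxE.
  have -> : (ord_pred i == d :> nat) = (i == d.+1 :> nat).
    case: i => -[|i] iN /=; last by rewrite modnDr modn_small ?eqSS // ltnW.
    by rewrite modn_small // [LHS]gtn_eqF.
  by case: ifP => _; rewrite ?rmorph0 //= /frob -exprM -expnSr.
by apply: shA; apply: IHd; apply: ltnW.
Qed.

Lemma lead0_monom_mx A v : v \in lead A 0 -> monom_mx 0 v \in A.
Proof.
case/mem_lead=> M /mem_deg_lt[MA M0] ->.
suff -> : monom_mx 0 (row (inord 0) M) = M by [].
apply/matrixP=> i j; rewrite !mxE.
case: eqP => [i0|/eqP i0]; last by rewrite M0 // lt0n.
rewrite expr1; congr (M _ _); apply: ord_inj; rewrite inordK //.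
Qed.

Lemma row_monom_mx d v :
  (d <= N)%N -> row (inord d) (monom_mx d v) = \row_j v 0 j ^+ (q ^ d).
Proof. by move=> dN; apply/rowP=> j; rewrite !mxE inordK ?eqxx. Qed.

Lemma lead_monom_mx A v d :
  (d <= N)%N -> monom_mx d v \in A -> \row_j v 0 j ^+ (q ^ d) \in lead A d.
Proof.
move=> dN dA; apply/mem_lead; exists (monom_mx d v); rewrite ?row_monom_mx //.
by apply/mem_deg_lt; split=> // i j di; rewrite mxE gtn_eqF.
Qed.

End HomogeneousRows.

(** * Lower bound for a shift-closed space *)

Section MainBound.

Variables (F : finFieldType) (L : fieldExtType F) (N m h : nat).
Variable alpha : 'I_m -> L.
Hypotheses (h_gt0 : (0 < h)%N) (hN : (h < N)%N).
Hypothesis alpha_neq0 : forall i, alpha i != 0.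
Hypothesis K_not_power :
  ~ exists b : L, b ^+ (\sum_(j < m) #|F| ^ j)%N = K_A alpha.
Local Notation q := #|F|.

Variables A D : {vspace 'M[L]_(N.+1, m)}.
Hypothesis shA : forall M, M \in A -> shift (@frob F L) M \in A.
Hypothesis DA : (D <= A)%VS.
Hypothesis dimD : (h < \dim D)%N.
Hypothesis D_deg : forall M (i : 'I_N.+1) j, M \in D -> (h.+1 < i)%N -> M i j = 0.
Hypothesis D_top : forall M j, M \in D ->
  M (inord h.+1) (ordS j) = M (inord h) j * alpha (ordS j).

(** In degree at most [h] row [h.+1] is zero, and by [D_top] row [h] vanishes with it, as the
    [alpha i] are nonzero. *)
Lemma lead_h_eq0 : lead D h = 0%VS.
Proof.
apply/eqP; rewrite -subv0; apply/subvP=> _ /mem_lead[M /mem_deg_lt[MD M0] ->].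
rewrite memv0; apply/eqP/rowP=> j; rewrite !mxE.
have := D_top j MD; rewrite M0 ?inordK // => /esym/eqP.
by rewrite mulf_eq0 (negPf (alpha_neq0 _)) orbF => /eqP.
Qed.

(** Degrees 0 to [h.+1] contribute at most 1 each to [\dim D], and degree [h] nothing; reaching
    [h.+1] forces all the others to contribute exactly 1. *)
Lemma lead_0_top_neq0 : (\dim (lead A h.+1) <= 1)%N ->
  lead D 0 != 0%VS /\ lead D h.+1 != 0%VS.
Proof.
move=> A_le1.
have D_le1 i : (i <= h.+1)%N -> (\dim (lead D i) <= 1)%N.
  move=> ih; apply: leq_trans (dimvS (lead_sub i DA)) _.
  by apply: leq_trans A_le1; apply: (leq_dim_lead shA).
have dimDE : \dim D = (\sum_(i < h.+2) \dim (lead D i))%N.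
  by rewrite -dim_deg_lt // deg_lt_full.
move: dimDE; rewrite 2!big_ord_recr /= lead_h_eq0 dimv0.
case: h h_gt0 dimD D_le1 => // h' _ dimD' D_le1; rewrite big_ord_recl /=.
set S := (\sum_(i < h') _)%N.
have : (S <= \sum_(i < h') 1)%N.
  by apply: leq_sum => i _; apply: D_le1; have := ltn_ord i; rewrite /bump /=; lia.
rewrite sum1_card card_ord -!dimv_eq0.
have := D_le1 _ (leq0n _); have := D_le1 _ (leqnn _).
move: dimD' S; move: (\dim D) (\dim (lead D 0)) (\dim (lead D _)).
by clear; lia.
Qed.

Lemma dim_shift_closed_ge : (2 * (N - h) <= \dim A)%N.
Proof.
have [A_gt1|A_le1] := ltnP 1 (\dim (lead A h.+1)).
  (* Each of the [N - h] degrees above [h] contributes at least 2. *)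
  rewrite dim_sum_lead -(big_mkord xpredT (fun i => \dim (lead A i))).
  rewrite (@big_cat_nat _ _ _ h.+1) //=; last by rewrite ltnS ltnW.
  apply: leq_trans (leq_addl _ _).
  have -> : (2 * (N - h) = \sum_(h.+1 <= i < N.+1) 2)%N.
    by rewrite sum_nat_const_nat subSS mulnC.
  rewrite !big_nat; apply: leq_sum => i /andP[hi iN].
  by apply: leq_trans A_gt1 _; apply: (leq_dim_lead shA).
case: K_not_power; have [lead0 leadS] := lead_0_top_neq0 A_le1.
have A_le1' : (\dim (lead A h) <= 1)%N.
  by apply: leq_trans A_le1; apply: (leq_dim_lead shA).
pose v := vpick (lead D 0).
have v_neq0 : v != 0 by rewrite vpick0.
have vA d : (d <= N)%N -> monom_mx N d v \in A.
  apply: (monom_mx_shift shA); apply: lead0_monom_mx.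
  exact: subvP (lead_sub 0 DA) _ (memv_pick _).
have [i vi_neq0] : exists i, v 0 i != 0 by apply/rV0Pn.
have vd_neq0 d : \row_j v 0 j ^+ (q ^ d) != 0.
  by apply/rV0Pn; exists i; rewrite mxE expf_neq0.
have /mem_lead[M /mem_deg_lt[MD _] MhE] := memv_pick (lead D h.+1).
have Mh_neq0 : row (inord h.+1) M != 0 by rewrite -MhE vpick0.
have MA : M \in A by apply: subvP DA _ MD.
have [t tE] : exists t, row (inord h.+1) M = t *: \row_j v 0 j ^+ (q ^ h.+1).
  apply: dim1_collinear A_le1 _ (lead_monom_mx hN (vA _ hN)) (vd_neq0 _).
  apply/mem_lead; exists M => //; apply/mem_deg_lt; split=> // k j; exact: D_deg.
have [s sE] : exists s, row (inord h) M = s *: \row_j v 0 j ^+ (q ^ h).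
  apply: dim1_collinear A_le1' _ (lead_monom_mx _ (vA _ _)) (vd_neq0 _);
    rewrite ?(ltnW hN) //.
  (* The subtraction cancels row [h.+1] of [M] and leaves row [h] intact, so that row [h] lies in
     [lead A h]. *)
  apply/mem_lead; exists (M - t *: monom_mx N h.+1 v).
    apply/mem_deg_lt; split=> [|k j]; first by rewrite rpredB ?rpredZ ?vA.
    rewrite leq_eqVlt => /predU1P[hk|hk].
      have /rowP/(_ j) := tE; rewrite !mxE hk inord_val eqxx => ->.
      by rewrite subrr.
    by rewrite !mxE (D_deg _ MD hk) gtn_eqF // mulr0 subr0.
  apply/rowP=> j; rewrite !mxE inordK ?ltn_eqF ?mulr0 ?subr0 //.
  by rewrite ltnW.
apply: (@K_A_power _ _ _ alpha (fun j => v 0 j ^+ (q ^ h)) s t).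
- by exists i; rewrite expf_neq0.
- by apply: contraNneq Mh_neq0 => t0; rewrite tE t0 scale0r.
move=> j; have := D_top j MD.
have /rowP/(_ (ordS j)) := tE; rewrite !mxE => ->.
by have /rowP/(_ j) := sE; rewrite !mxE => ->; rewrite -exprM -expnSr.
Qed.

End MainBound.

(** * Linear forms vanishing on an L-subspace *)

Section Annihilator.

Variables (L : fieldType) (k m : nat).
Implicit Type v : {ffun 'I_(k * m) -> L^o}.

(** Forms are kept as matrices, flattened as in [V_vec], so that row [i] of [c] pairs with block [i]
    of the vector. *)
Definition dot (c : 'M[L]_(k, m)) v : L := \sum_l mxvec c 0 l * v l.

Lemma dot_linear c : linear (dot c : {ffun 'I_(k * m) -> L^o} -> L^o).
Proof.
move=> a v w; rewrite /dot scaler_sumr -big_split; apply: eq_bigr => l _.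
by rewrite !ffunE mulrDr scalerAr.
Qed.

HB.instance Definition _ c :=
  GRing.isLinear.Build L {ffun 'I_(k * m) -> L^o} L^o _ (dot c) (dot_linear c).

Definition dots p (X : p.-tuple {ffun 'I_(k * m) -> L^o}) (c : 'M[L]_(k, m)) :
  'rV[L]_p := \row_i dot c X`_i.

Lemma dots_linear p X : linear (@dots p X).
Proof.
move=> a c c'; apply/rowP=> i; rewrite !mxE /dot mulr_sumr -big_split.
by apply: eq_bigr => l _; rewrite linearP !mxE mulrDl mulrA.
Qed.

HB.instance Definition _ p X :=
  GRing.isLinear.Build L 'M[L]_(k, m) 'rV[L]_p _ (@dots p X) (@dots_linear p X).

Definition annihilator (H : {vspace {ffun 'I_(k * m) -> L^o}}) :
  {vspace 'M[L]_(k, m)} := lker (linfun (dots (vbasis H))).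

Lemma annihilator_dot (H : {vspace {ffun 'I_(k * m) -> L^o}}) c v :
  c \in annihilator H -> v \in H -> dot c v = 0.
Proof.
rewrite memv_ker lfunE /= => /eqP/rowP c0 vH.
rewrite (coord_vbasis vH) linear_sum big1 // => i _.
by rewrite linearZ /=; have := c0 i; rewrite !mxE => ->; rewrite scaler0.
Qed.

Lemma dim_annihilator (H : {vspace {ffun 'I_(k * m) -> L^o}}) :
  (k * m <= \dim (annihilator H) + \dim H)%N.
Proof.
have := limg_ker_dim (linfun (dots (vbasis H))) fullv.
rewrite capfv dimvf dim_matrix => dimE.
apply: (@leq_trans (_ + _)%N); first exact: (eq_leq (esym dimE)).
rewrite leq_add2l.
by apply: leq_trans (dimvS (subvf _)) _; rewrite dimvf dim_matrix mul1r.
Qed.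

End Annihilator.

(** * Linear forms pulled back to q-polynomials *)

Section CoefficientMatrix.

Variables (F : finFieldType) (L : fieldExtType F) (N m h : nat).
Variable alpha : 'I_m -> L.
Hypothesis hN : (h < N)%N.
Local Notation q := #|F|.

(* The coefficients of [x |-> dot c (V_vec alpha h x)] as a q-polynomial. *)
Definition coef_mx (c : 'M[L]_(h.+1, m)) : 'M[L]_(N.+1, m) :=
  \matrix_(i, j) if (i <= h)%N then c (inord i) j
                 else if i == h.+1 :> nat then c ord_max (ord_pred j) * alpha j
                 else 0.

Lemma coef_mx_linear : linear coef_mx.
Proof.
move=> a c c'; apply/matrixP=> i j; rewrite !mxE.
case: ifP => _ //; case: ifP => _; last by rewrite mulr0 addr0.
by rewrite mulrDl mulrA.
Qed.

HB.instance Definition _ :=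
  GRing.isLinear.Build L 'M[L]_(h.+1, m) 'M[L]_(N.+1, m) _ coef_mx coef_mx_linear.

Lemma coef_mx_inj c : coef_mx c = 0 -> c = 0.
Proof.
move=> c0; apply/matrixP=> i j; rewrite mxE.
have iN : (i < N.+1)%N by have := ltn_ord i; lia.
have /matrixP/(_ (inord i) j) := c0; rewrite !mxE inordK //.
by rewrite -ltnS ltn_ord inord_val.
Qed.

Lemma q_eval_coef_mx c x : q_eval (coef_mx c) x = dot c (V_vec alpha h x).
Proof.
(* Indexing the rows by [nat] lets the sum be cut at [h.+2], beyond which all rows vanish. *)
pose T i := \sum_(j < m) (if (i <= h)%N then c (inord i) j
                 else if i == h.+1 :> nat then c ord_max (ord_pred j) * alpha j
                 else 0) * x j ^+ (q ^ i).
have -> : q_eval (coef_mx c) x = \sum_(0 <= i < N.+1) T i.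
  by rewrite big_mkord; apply: eq_bigr => i _; apply: eq_bigr => j _; rewrite mxE.
rewrite (@big_cat_nat _ _ _ h.+2) //= [X in _ + X]big_nat.
rewrite [X in _ + X]big1 ?addr0; last first.
  move=> i /andP[hi _]; apply: big1 => j _.
  by rewrite leqNgt ltnW //= gtn_eqF ?mul0r.
have -> : dot c (V_vec alpha h x) = \sum_i \sum_j c i j *
    (if (i < h)%N then x j ^+ (q ^ i) else f_A alpha h j x).
  rewrite /dot pair_bigA /= (reindex _ (curry_mxvec_bij _ _)) /=.
  by apply: eq_bigr => -[i j] _; rewrite !ffunE !mxvecE !mxE.
rewrite big_mkord 2!big_ord_recr /= [RHS]big_ord_recr /= -addrA; congr (_ + _).
  apply: eq_bigr => i _; apply: eq_bigr => j _.
  rewrite (ltnW (ltn_ord i)) ltn_ord; congr (c _ _ * _).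
  by apply: ord_inj; rewrite inordK //= ltnS ltnW.
(* The cyclic reindexing aligns row [h.+1] with the variable [x (ordS j)] of [f_A]. *)
rewrite ltnn /T leqnn ltnn eqxx [X in _ + X](reindex_inj (@ordS_inj _)) -big_split.
apply: eq_bigr => j _; rewrite ordSK /f_A mulrDr mulrA.
by congr (c _ _ * _ + _); apply: ord_inj; rewrite inordK.
Qed.

End CoefficientMatrix.

(** * Evasiveness of [V_A] *)

Theorem theorem4p6 (F : finFieldType) (L : fieldExtType F) (n m h : nat)
    (hn : \dim {:L} = n) (hm : (3 <= m)%N) (hh : (2 <= h <= n - 2)%N)
    (alpha : 'I_m -> L) (halpha : forall i, alpha i != 0)
    (hK : ~ exists b : L, b ^+ (\sum_(j < m) #|F| ^ j)%N = K_A alpha) :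
  evasive (m * (h + 1) - (h + 1)) (m * n - (2 * n - 2 * h - 2)) (V_A alpha h).
Proof.
have [N nE] : exists N, n = N.+1 by exists n.-1; lia.
rewrite nE in hn hh *; have hN : (h < N)%N by lia.
split; [by nia | by nia | by nia |] => H dimH.
pose W := (linfun (V_vec alpha h) @^-1: restrict_scalars H)%VS.
pose A := q_ann N W.
pose D := (linfun (coef_mx (h := h) N alpha) @: annihilator H)%VS.
have memW x : (x \in W) = (V_vec alpha h x \in restrict_scalars H).
  by rewrite -memv_preim lfunE.
have DA : (D <= A)%VS.
  apply/subvP=> _ /memv_imgP[c cH ->]; rewrite lfunE; apply/mem_q_ann=> x.
  rewrite memW mem_restrict_scalars q_eval_coef_mx //.
  exact: annihilator_dot.
(* [H] has codimension [h.+1], and [coef_mx] keeps the forms vanishing on it independent. *)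
have dimD : (h < \dim D)%N.
  rewrite limg_dim_eq.
    by have := dim_annihilator H; rewrite dimH; move: (\dim _); clear -hm; nia.
  apply/eqP; rewrite -subv0; apply/subvP=> c; rewrite memv_cap memv_ker lfunE.
  by case/andP=> _ /eqP /coef_mx_inj -> //; rewrite memv0.
have D_deg (M : 'M[L]_(N.+1, m)) (i : 'I_N.+1) j :
    M \in D -> (h.+1 < i)%N -> M i j = 0.
  case/memv_imgP=> c _ -> hi; rewrite lfunE /= mxE leqNgt ltnW //=.
  by rewrite gtn_eqF.
have D_top (M : 'M[L]_(N.+1, m)) j :
    M \in D -> M (inord h.+1) (ordS j) = M (inord h) j * alpha (ordS j).
  case/memv_imgP=> c _ ->; rewrite lfunE /= !mxE !inordK ?ltnS ?(ltnW hN) //.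
  rewrite ltnn leqnn eqxx ordSK; congr (c _ _ * _); apply: ord_inj.
  by rewrite inordK.
have dimA : (2 * (N - h) <= \dim A)%N.
  apply: (dim_shift_closed_ge _ hN halpha hK _ DA dimD D_deg D_top); first by lia.
  exact: shift_q_ann.
have dimW := dim_q_ann hn W.
have : (\dim (V_A alpha h :&: restrict_scalars H) <= \dim W)%N.
  have VW : (V_A alpha h :&: restrict_scalars H <=
             linfun (V_vec alpha h) @: W)%VS.
    apply/subvP=> v; rewrite memv_cap => /andP[/mem_V_A[x ->] xH].
    by apply/memv_imgP; exists x; rewrite ?memW ?lfunE.
  apply: leq_trans (dimvS VW) _.
  by rewrite -(limg_ker_dim (linfun (V_vec alpha h)) W) leq_addl.
(* As [N = n - 1], the bound [2 * (N - h)] equals [2 * n - 2 * h - 2]. *)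
move: dimA dimW; rewrite -/A.
by move: (\dim A) (\dim W) (\dim (_ :&: _)%VS); clear; lia.
Qed.
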